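(* Let $\mathbb{B}$ be a Banach space, $d\in\mathbb{N}$, let $\|\cdot\|$ be the norm associated with $\mathbb{B}^d$ and $\|\cdot\|_*$ its dual norm. Suppose the mirror map $M:\mathbb{B}^d\to\mathbb{R}$ satisfies $$\|\nabla M^*(\nabla M(x)-y)-x\|\le L_M\|y\|$$ with $L_M>0$. Let $\tau\in\mathbb{N}$, $R,L'>0$. Run Delayed Correlated Online Mirror Descent with mirror map $M$, delay $\tau$, convex losses $f_t$, influence functions $\Phi_{t+1}(x_k^{t+1})=\beta_t x_k^{t+1}$, and $$\eta_t=\beta_t=\frac{\sigma}{\sqrt{t-\tau}}\quad(t>\tau),\qquad \sigma>0,\quad \sigma^2=\frac{R^2}{\tau L_M L'^2}.$$ Assume that $\|\tilde g_{t-\tau}\|_*\le L'$ for all $t>\tau$, where $\tilde g_{t-\tau}=g_{t-\tau}-\frac{\beta_t}{\eta_t}\Phi_{t+1}(x_k^{t+1})$, and that $\|x_k^t\|_*\le R$ and $\|\hat{x}_u^t\|_*\le R$ for all $t$. Then the regret $R(T)=\sum_{t=1}^T f_t(\hat{x}_u^t)-\min_{x\in\mathcal{K}}\sum_{t=1}^T f_t(x)$ satisfies $$R(T)\le C_3\sqrt{L_M\,\tau\,T},$$ where $C_3$ is a constant independent of $\tau$ and $T$.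
   Context: At each round $t$ an agent has a known context $x_k^t\in\mathbb{B}^d$ and an unknown context $x_u^t\in\mathbb{B}^d$, the latter revealed only after a fixed delay of $\tau$ rounds; no distributional assumption is made, the contexts are arbitrary points of a convex set $\mathcal{K}\subset\mathbb{B}^d$, which is also the set of admissible decisions and contains the iterates $\hat{x}_u^t$. The losses are convex functions of the form $f_t(x)=f(\|x-x_u^t\|)$, where $f:[0,\infty)\to[0,\infty)$ (possibly depending on $t$) is increasing with $f(0)=0$; $\nabla f_t$ denotes the gradient (a subgradient where $f_t$ is not differentiable). $M^*(y)=\sup_x\langle x,y\rangle-M(x)$ is the Fenchel dual of $M$. Elements of the space and of its dual are identified through the pairing $\langle\cdot,\cdot\rangle$, so that both $\|\cdot\|$ and $\|\cdot\|_*$ may be applied to contexts, iterates and gradients. Delayed Correlated Online Mirror Descent. Inputs: mirror map $M$, step sizes $\eta_t$, delay $\tau$, influence functions $\Phi_t$, weights $\beta_t$. Set $\hat{x}_u^1=\dots=\hat{x}_u^\tau=\hat{x}_u^{\tau+1}=0$. For $t=\tau+1,\dots,T+\tau$: incur loss $f_t(\hat{x}_u^t)$; compute $g_{t-\tau}=\nabla f_{t-\tau}(\hat{x}_u^{t-\tau})$; update $$\hat{x}_u^{t+1}=\nabla M^*\big(\nabla M(\hat{x}_u^t)-\eta_t g_{t-\tau}+\beta_t\Phi_{t+1}(x_k^{t+1})\big).$$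
   Formalization: The formal theorem additionally assumes that the Bregman divergence of M between a minimiser x* over K and the iterates x̂_u^t (τ<t≤T+τ) is at most some D, and C_3 may depend on D; without such a bound the claim fails, e.g. for unbounded K. *)

(* Defs.v *)
From HB Require Import structures.
From mathcomp Require Import all_boot all_order all_algebra.
From mathcomp Require Import all_classical all_reals all_analysis.

Set Implicit Arguments.
Unset Strict Implicit.
Unset Printing Implicit Defensive.

Import Order.TTheory GRing.Theory Num.Theory.
Import numFieldNormedType.Exports.

Local Open Scope classical_set_scope.
Local Open Scope ring_scope.

Section Space.
Context (R : realType) (B : completeNormedModType R) (d : nat).
Local Notation E := {ffun 'I_d -> B}.
Implicit Types (N : E -> R) (p : E -> E -> R).

(* N is a norm on B^d inducing the product topology (the last clause, which
   compares N with the l^1 product norm); (B^d, N) is then a Banach space. *)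
Definition product_norm N : Prop :=
  [/\ forall x, N x = 0 -> x = 0,
      forall x y, N (x + y) <= N x + N y,
      forall (a : R) x, N (a *: x) = `|a| * N x
    & exists c C : R, [/\ 0 < c, 0 < C &
        forall x : E, c * (\sum_i `|x i|) <= N x /\ N x <= C * (\sum_i `|x i|)]].

(* The second argument of p is the one read as an element of the dual. *)
Definition dual_norm N p (y : E) : R :=
  sup [set `|p x y| | x in [set x | N x <= 1]].

(* p identifies (B^d, N) with its topological dual through y |-> p(., y):
   this map is well defined (p is bilinear and bounded), onto, and bicontinuous.
   Continuity of the inverse, hence injectivity, is spelled out; by the bounded
   inverse theorem it is the same as injectivity. *)
Record duality_pairing N p : Prop := {
  pairing_linl : forall (a : R) x x' y, p (a *: x + x') y = a * p x y + p x' y;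
  pairing_linr : forall (a : R) x y y', p x (a *: y + y') = a * p x y + p x y';
  pairing_bounded : exists C : R, forall x y, `|p x y| <= C * N x * N y;
  pairing_onto : forall phi : {linear E -> R^o},
    (exists C : R, forall x, `|phi x : R| <= C * N x) ->
    exists y, forall x, phi x = p x y;
  pairing_inverse_bounded : exists c : R, forall y, N y <= c * dual_norm N p y
}.

(* h has Gateaux derivative l at x. *)
Definition gateaux (h : E -> R) (x : E) (l : E -> R) : Prop :=
  forall v, is_derive (0 : R) (1 : R) (fun s : R => h (x + s *: v)) (l v).

Definition fenchel p (M : E -> R) (y : E) : \bar R :=
  ereal_sup [set (p x y - M x)%:E | x in [set: E]].

(* M is convex and differentiable with gradient dM (dual elements), and its
   Fenchel dual is finite and differentiable with gradient dMs (primal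
   elements).  Gateaux differentiability, the weakest notion, is enough. *)
Record mirror_map p (M : E -> R) (dM dMs : E -> E) : Prop := {
  mirror_convex : convex_function setT M;
  mirror_grad : forall x, gateaux M x (fun v => p v (dM x));
  mirror_dual_fin : forall y, fenchel p M y \is a fin_num;
  mirror_dual_grad :
    forall y, gateaux (fun z => fine (fenchel p M z)) y (fun v => p (dMs y) v)
}.

Definition bregman p (M : E -> R) (dM : E -> E) (x y : E) : R :=
  M x - M y - p (x - y) (dM y).

(* Where the convex function h is differentiable this says that g is its
   gradient. *)
Definition subgradient p (h : E -> R) (x g : E) : Prop :=
  forall z, h x + p (z - x) g <= h z.

Definition loss N (f : nat -> R -> R) (xu : nat -> E) (t : nat) (x : E) : R :=
  f t (N (x - xu t)).

(* "Increasing" is read as nondecreasing. *)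
Record admissible_losses N (f : nat -> R -> R) (xu : nat -> E) : Prop := {
  profile_ge0 : forall t a, 0 <= a -> 0 <= f t a;
  profile_increasing : forall t a b, 0 <= a -> a <= b -> f t a <= f t b;
  profile0 : forall t, f t 0 = 0;
  loss_convex : forall t, convex_function setT (loss N f xu t)
}.

Definition cumulative_loss N f xu (T : nat) (x : E) : R :=
  \sum_(1 <= t < T.+1) loss N f xu t x.

(* The losses are nonnegative, so that the infimum over a nonempty K is a
   genuine one; it is the minimum whenever the latter exists. *)
Definition regret N f xu (K : set E) (xhat : nat -> E) (T : nat) : R :=
  \sum_(1 <= t < T.+1) loss N f xu t (xhat t)
  - inf [set cumulative_loss N f xu T x | x in K].

(* Rounds are numbered from 1; index 0 of every sequence is unused.  g s is the
   (sub)gradient taken at round s and used at round s + tau. *)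
Record DCOMD N p (dM dMs : E -> E) (tau T : nat) (eta beta : nat -> R)
    (Phi : nat -> E -> E) (f : nat -> R -> R)
    (xk xu xhat g : nat -> E) : Prop := {
  DCOMD_init : forall t, (1 <= t <= tau.+1)%N -> xhat t = 0;
  DCOMD_grad : forall t, (tau < t <= T + tau)%N ->
    subgradient p (loss N f xu (t - tau)) (xhat (t - tau)%N) (g (t - tau)%N);
  DCOMD_update : forall t, (tau < t <= T + tau)%N ->
    xhat t.+1 = dMs (dM (xhat t) - eta t *: g (t - tau)%N
                     + beta t *: Phi t.+1 (xk t.+1))
}.

End Space.

(* Main.v *)
(* With s = t - tau and x_t the iterates, the regret of round s is at most
   <x_s - xstar, g_s>, which splits into <x_s - x_t, g~_s>, <x_t - xstar, g~_s>
   and beta_t <x_s - xstar, xk_(t+1)>.  The first is the drift of tau steps of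
   size O(L_M eta), the second telescopes in Bregman divergences, and the third
   is O(beta_t).  Since dM inverts dMs (Fenchel biconjugation), the hypothesis on
   dMs makes the divergence control pairings: this gives the descent estimate,
   and also bounds <x_t - xstar, xk_(t+1)>, whence no bound on K is needed. *)

Require Import Defs.
From HB Require Import structures.
From mathcomp Require Import all_boot all_order all_algebra.
From mathcomp Require Import all_classical all_reals all_analysis.
From mathcomp Require Import ring lra.
Import Order.TTheory GRing.Theory Num.Theory.
Import numFieldNormedType.Exports.
Set Implicit Arguments.
Unset Strict Implicit.

Local Open Scope classical_set_scope.
Local Open Scope ring_scope.

(** * One-sided slopes and the gradient inequality *)

Lemma is_derive_le_slope (R : realType) (h : R -> R) (l a : R) :
  is_derive (0 : R) (1 : R) h l ->
  (forall s, 0 < s -> s < 1 -> h s <= h 0 + s * a) -> l <= a.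
Proof.
move=> [dh <-] ha; rewrite /derive.
have cv := cvg_dnbhs_at_right dh.
rewrite cvg_at_rightE//.
apply: limr_le; first exact: cvgP cv.
near=> s.
have s0 : 0 < s by near: s; exact: nbhs_right_gt.
have s1 : s < 1 by near: s; exact: nbhs_right_lt.
rewrite /= addr0 -[_ *: 1]/(s * 1) mulr1 -[_ *: _]/(_ * _).
by rewrite mulrC ler_pdivrMr// mulrC lerBlDl ha.
Unshelve. all: by end_near. Qed.

Section ProductSpace.
Context (R : realType) (B : completeNormedModType R) (d : nat).
Local Notation E := {ffun 'I_d -> B}.
Implicit Types (x y z : E).

(** Only the chord inequality on one segment is asked, so that this serves both [M], convex by
    hypothesis, and its Fenchel dual, a supremum of affine functions. *)
Lemma gateaux_convex (h : E -> R) x z (l : E -> R) :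
  (forall s, 0 < s -> s < 1 ->
     h (x + s *: (z - x)) <= h x + s * (h z - h x)) ->
  gateaux h x l -> h x + l (z - x) <= h z.
Proof.
move=> hc hl; rewrite -lerBrDl.
apply: (is_derive_le_slope (hl (z - x))) => s s0 s1.
by rewrite scale0r addr0 hc.
Qed.

(** * The norm, the pairing and the dual norm *)

Section Pairing.
Context (N : E -> R) (p : E -> E -> R).
Hypotheses (hN : product_norm N) (hp : duality_pairing N p).

Lemma pairing0l y : p 0 y = 0.
Proof.
by have := pairing_linl hp 1 0 0 y; rewrite scale1r addr0 mul1r; lra.
Qed.

Lemma pairing0r x : p x 0 = 0.
Proof.
by have := pairing_linr hp 1 x 0 0; rewrite scale1r addr0 mul1r; lra.
Qed.

Lemma pairingZl a x y : p (a *: x) y = a * p x y.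
Proof. by rewrite -[a *: x]addr0 (pairing_linl hp) pairing0l addr0. Qed.

Lemma pairingZr a x y : p x (a *: y) = a * p x y.
Proof. by rewrite -[a *: y]addr0 (pairing_linr hp) pairing0r addr0. Qed.

Lemma pairingDl x x' y : p (x + x') y = p x y + p x' y.
Proof. by rewrite -{1}[x]scale1r (pairing_linl hp) mul1r. Qed.

Lemma pairingDr x y y' : p x (y + y') = p x y + p x y'.
Proof. by rewrite -{1}[y]scale1r (pairing_linr hp) mul1r. Qed.

Lemma pairingNl x y : p (- x) y = - p x y.
Proof. by rewrite -scaleN1r pairingZl mulN1r. Qed.

Lemma pairingNr x y : p x (- y) = - p x y.
Proof. by rewrite -scaleN1r pairingZr mulN1r. Qed.

Lemma product_normZ a x : N (a *: x) = `|a| * N x.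
Proof. by case: hN. Qed.

Lemma product_norm_triangle x y : N (x + y) <= N x + N y.
Proof. by case: hN. Qed.

Lemma product_norm0 : N 0 = 0.
Proof. by rewrite -(scale0r (0 : E)) product_normZ normr0 mul0r. Qed.

Lemma product_normN x : N (- x) = N x.
Proof. by rewrite -scaleN1r product_normZ normrN1 mul1r. Qed.

Lemma product_norm_ge0 x : 0 <= N x.
Proof.
have := product_norm_triangle x (- x).
by rewrite subrr product_norm0 product_normN; lra.
Qed.

Lemma has_ubound_dual_norm y :
  has_ubound [set `|p x y| | x in [set x | N x <= 1]].
Proof.
have [C hC] := pairing_bounded hp.
(* The sign of [C] is unknown, hence the absolute value. *)
exists (`|C| * N y) => _ [x /= x1 <-]; apply: le_trans (hC x y) _.
rewrite ler_wpM2r ?product_norm_ge0//.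
apply: le_trans (ler_norm _) _; rewrite normrM ler_piMr//.
by rewrite ger0_norm ?product_norm_ge0.
Qed.

Lemma dual_norm_ge0 y : 0 <= dual_norm N p y.
Proof.
apply: le_trans (normr_ge0 (p 0 y)) _.
apply: ub_le_sup (has_ubound_dual_norm y) _ _.
by exists 0; rewrite //= product_norm0.
Qed.

Lemma le_pairing x y : p x y <= N x * dual_norm N p y.
Proof.
have [N0 _ _ _] := hN.
have [/N0 ->|Nx0] := eqVneq (N x) 0.
  by rewrite pairing0l product_norm0 mul0r.
have Nx_gt0 : 0 < N x by rewrite lt_neqAle eq_sym Nx0 product_norm_ge0.
rewrite mulrC -ler_pdivrMr// mulrC -pairingZl.
apply: le_trans (ler_norm _) _; apply: ub_le_sup (has_ubound_dual_norm y) _ _.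
exists ((N x)^-1 *: x) => //=.
by rewrite product_normZ ger0_norm ?invr_ge0 ?product_norm_ge0// mulVf.
Qed.

Lemma dual_normZ_le a y : dual_norm N p (a *: y) <= `|a| * dual_norm N p y.
Proof.
apply: ge_sup.
  by exists `|p 0 (a *: y)|; exists 0 => //=; rewrite product_norm0.
move=> _ [x /= x1 <-]; rewrite pairingZr normrM ler_wpM2l//.
by apply: ub_le_sup (has_ubound_dual_norm y) _ _; exists x.
Qed.

Lemma product_norm_telescope (x : nat -> E) (s n : nat) :
  N (x (s + n)%N - x s) <= \sum_(i < n) N (x (s + i).+1 - x (s + i)%N).
Proof.
elim: n => [|n IH]; first by rewrite big_ord0 addn0 subrr product_norm0.
rewrite big_ord_recr/= addnS -(subrKA (x (s + n)%N)) [leRHS]addrC.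
by apply: le_trans (product_norm_triangle _ _) _; rewrite lerD2l.
Qed.

(** * Fenchel duality and the mirror step *)

Section MirrorMap.
Context (M : E -> R) (dM dMs : E -> E).
Hypothesis hM : mirror_map p M dM dMs.
Local Notation Mstar := (fun y => fine (fenchel p M y)).

Lemma fenchel_young x y : p x y - M x <= fine (fenchel p M y).
Proof.
rewrite -lee_fin fineK ?(mirror_dual_fin hM)//.
by apply: ereal_sup_ubound; exists x.
Qed.

Lemma fine_fenchel_le y a :
  (forall x, p x y - M x <= a) -> fine (fenchel p M y) <= a.
Proof.
move=> ha; rewrite -lee_fin fineK ?(mirror_dual_fin hM)//.
by apply: ge_ereal_sup => _ [x _ <-]; rewrite lee_fin.
Qed.

Lemma mirror_gradient_le x z : M x + p (z - x) (dM x) <= M z.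
Proof.
apply: (gateaux_convex (l := fun v => p v (dM x))) (mirror_grad hM x) => s s0 s1.
pose t := Itv01 (ltW s0) (ltW s1).
have := mirror_convex hM t (mem_set (I : setT z)) (mem_set (I : setT x)).
have -> : conv t (z : convex_lmodType E) x = x + s *: (z - x).
  rewrite /conv/= /unstable.onem scalerBr scalerBl scale1r /=.
  by rewrite addrCA.
by rewrite convRE/= /unstable.onem => /le_trans; apply; lra.
Qed.

Lemma fenchel_gradient_le y z : Mstar y + p (dMs y) (z - y) <= Mstar z.
Proof.
apply: (gateaux_convex (l := fun v => p (dMs y) v)) (mirror_dual_grad hM y).
move=> s s0 s1; apply: fine_fenchel_le => x.
(* For fixed [x] the expression is affine in the dual variable: Fenchel-Young at [y] and [z], with
   weights [1 - s] and [s], bounds it. *)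
rewrite pairingDr pairingZr pairingDr pairingNr.
have := fenchel_young x y; have := fenchel_young x z; nra.
Qed.

(* Biconjugation: dMs y attains the supremum defining the Fenchel dual at y,
   hence it is a critical point of p(., y) - M. *)
Lemma mirror_gradK y : dM (dMs y) = y.
Proof.
set x := dMs y.
(* Equality case of Fenchel-Young: the gradient inequality of the dual from [y] to [dM x] is
   combined with the value of the dual at [dM x], where [x] attains the supremum. *)
have Mx : M x + fine (fenchel p M y) <= p x y.
  have : fine (fenchel p M (dM x)) <= p x (dM x) - M x.
    apply: fine_fenchel_le => z; have := mirror_gradient_le x z.
    by rewrite pairingDl pairingNl; lra.
  have := fenchel_gradient_le y (dM x).
  by rewrite pairingDr pairingNr -/x; lra.
(* By [Mx], [x] minimizes [M - p(., y)], so the slope of [- M] along [v] is at most [- p v y]. Using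
   [- v] as well then gives equality. *)
have le_v v : p v y <= p v (dM x).
  have := mirror_grad hM x v => /is_deriveN /is_derive_le_slope.
  move=> /(_ (- p v y)); rewrite lerN2; apply=> s s0 s1 /=.
  have := fenchel_young (x + s *: v) y.
  by rewrite !fctE scale0r addr0 pairingDl pairingZl; lra.
have eq_v v : p v (dM x - y) = 0.
  have := le_v v; have := le_v (- v).
  by rewrite !pairingNl pairingDr pairingNr; lra.
have [c hc] := pairing_inverse_bounded hp.
have dual0 : dual_norm N p (dM x - y) = 0.
  rewrite /dual_norm (_ : image _ _ = [set 0]) ?sup1//.
  apply/seteqP; split => [_ [v /= _ <-]|_ ->]; first by rewrite eq_v normr0.
  by exists 0; rewrite /= ?product_norm0// eq_v normr0.
have [N0 _ _ _] := hN.
apply/subr0_eq/N0/le_anti; rewrite product_norm_ge0 andbT.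
by rewrite (le_trans (hc _))// dual0 mulr0.
Qed.

Lemma bregman_ge0 x z : 0 <= bregman p M dM x z.
Proof. by have := mirror_gradient_le z x; rewrite /bregman; lra. Qed.

(** Three-point identity: with [x'] the new point, [dM x' = dM x - y], so [p (x' - xs) y] is the
    difference of the two divergences minus the divergence of [x'] from [x], which is nonnegative.
    The rest, [p (x - x') y], is bounded by the step length. *)
Lemma mirror_step (L : R) x y xs :
  (forall u v, N (dMs (dM u - v) - u) <= L * N v) ->
  p (x - xs) y <= bregman p M dM xs x - bregman p M dM xs (dMs (dM x - y))
                  + L * N y * dual_norm N p y.
Proof.
move=> hL; set x' := dMs (dM x - y).
have dMx' : dM x' = dM x - y by rewrite mirror_gradK.
have : p (x - x') y <= L * N y * dual_norm N p y.
  apply: le_trans (le_pairing _ _) _; rewrite ler_wpM2r ?dual_norm_ge0//.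
  by rewrite -product_normN opprB hL.
have := mirror_gradient_le x x'.
rewrite /bregman dMx' !pairingDr !pairingNr !pairingDl !pairingNl; lra.
Qed.

End MirrorMap.
End Pairing.
End ProductSpace.

(** * Inverse square roots and summation by parts *)

Section Sums.
Context {R : realType}.

(** For the two roots, [a ^+ 2 - b ^+ 2 = 1]; after multiplication by [a] the claim becomes
    [(a - b) ^+ 2 >= 0]. *)
Lemma invsqrt_le (n : nat) :
  (Num.sqrt n.+1%:R : R)^-1 <= 2 * Num.sqrt n.+1%:R - 2 * Num.sqrt n%:R.
Proof.
set a : R := Num.sqrt n.+1%:R; set b : R := Num.sqrt n%:R.
have a0 : 0 < a by rewrite sqrtr_gt0 ltr0n.
have a2 : a ^+ 2 = n%:R + 1 by rewrite sqr_sqrtr ?ler0n// -natr1.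
have b2 : b ^+ 2 = n%:R by rewrite sqr_sqrtr ?ler0n.
rewrite -[leLHS]mul1r ler_pdivrMr//.
have := sqr_ge0 (a - b); nra.
Qed.

(* The junk values (sqrt 0)^-1 = 0 and s - k = 0 for s <= k make the shifted sum
   start at s = k + 1. *)
Lemma sum_invsqrt_le (k T : nat) :
  \sum_(1 <= s < T.+1) (Num.sqrt (s - k)%:R : R)^-1 <= 2 * Num.sqrt (T - k)%:R.
Proof.
elim: T => [|T IH]; first by rewrite big_geq// mulr_ge0 ?sqrtr_ge0.
rewrite big_nat_recr//=; have [kT|Tk] := leqP k T.
  rewrite subSn//; have := invsqrt_le (T - k); lra.
have /eqP -> : (T.+1 - k == 0)%N by rewrite subn_eq0.
rewrite sqrtr0 invr0 addr0 mulr0; apply: le_trans IH _.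
have /eqP -> : (T - k == 0)%N by rewrite subn_eq0 ltnW.
by rewrite sqrtr0 mulr0.
Qed.

(** After exchanging the sums, each of the [tau] offsets contributes a shifted sum of at most
    [2 * Num.sqrt T]. This is the cost of the delay. *)
Lemma sum_invsqrt_window (tau T : nat) :
  \sum_(1 <= s < T.+1) \sum_(i < tau) (Num.sqrt (s + i - tau)%:R : R)^-1
  <= tau%:R * (2 * Num.sqrt T%:R).
Proof.
rewrite exchange_big/= -[tau in leRHS]card_ord -sumr_const mulr_suml.
apply: ler_sum => i _; rewrite mul1r.
have -> : \sum_(1 <= s < T.+1) (Num.sqrt (s + i - tau)%:R : R)^-1 =
          \sum_(1 <= s < T.+1) (Num.sqrt (s - (tau - i))%:R)^-1.
  by apply: eq_bigr => s _; rewrite subnBA// ltnW.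
apply: le_trans (sum_invsqrt_le _ _) _.
by rewrite ler_wpM2l// ler_sqrt ?ler0n// ler_nat leq_subr.
Qed.

(** Each new term is absorbed because [(w T.+1 - w T) * (D - b T.+1) >= 0]. Here [w] will be the
    inverse step size and [b] the divergence to the comparator. *)
Lemma abel_sum_le (b w : nat -> R) (D : R) (T : nat) :
  w 0%N = 0 -> (forall n, w n <= w n.+1) ->
  (forall s, (1 <= s <= T)%N -> b s <= D) ->
  \sum_(1 <= s < T.+1) w s * (b s - b s.+1) <= w T * D - w T * b T.+1.
Proof.
move=> w0 w_incr; elim: T => [|T IH] bD; first by rewrite big_geq// w0; lra.
rewrite big_nat_recr//=.
have := IH (fun s hs => bD s ltac:(by case/andP: hs => -> /leqW)).
have := w_incr T; have := bD T.+1 (leqnn _); nra.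
Qed.
End Sums.

(** * The regret bound *)

Theorem theorem3 (R : realType) (B : completeNormedModType R) (d : nat)
    (N : {ffun 'I_d -> B} -> R)
    (p : {ffun 'I_d -> B} -> {ffun 'I_d -> B} -> R)
    (M : {ffun 'I_d -> B} -> R)
    (dM dMs : {ffun 'I_d -> B} -> {ffun 'I_d -> B})
    (K : set {ffun 'I_d -> B})
    (LM L' rad D : R)
    (hN : product_norm N) (hp : duality_pairing N p)
    (hM : mirror_map p M dM dMs)
    (hK : convex_set K)
    (hLM : 0 < LM) (hL' : 0 < L') (hrad : 0 < rad)
    (hMLM : forall x y : {ffun 'I_d -> B}, N (dMs (dM x - y) - x) <= LM * N y) :
  exists C3 : R,
  forall (tau T : nat) (sigma : R) (eta beta : nat -> R)
    (Phi : nat -> {ffun 'I_d -> B} -> {ffun 'I_d -> B})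
    (f : nat -> R -> R)
    (xk xu xhat g : nat -> {ffun 'I_d -> B}) (xstar : {ffun 'I_d -> B}),
    (0 < tau)%N ->
    0 < sigma ->
    sigma ^+ 2 = rad ^+ 2 / (tau%:R * LM * L' ^+ 2) ->
    (forall t, (tau < t)%N -> eta t = sigma / Num.sqrt (t - tau)%:R) ->
    (forall t, (tau < t)%N -> beta t = sigma / Num.sqrt (t - tau)%:R) ->
    (forall t, (tau < t <= T + tau)%N ->
       Phi t.+1 (xk t.+1) = beta t *: xk t.+1) ->
    admissible_losses N f xu ->
    (forall t, (1 <= t <= (T + tau).+1)%N -> K (xk t) /\ K (xu t)) ->
    (forall t, (1 <= t <= (T + tau).+1)%N -> K (xhat t)) ->
    DCOMD N p dM dMs tau T eta beta Phi f xk xu xhat g ->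
    (forall t, (tau < t <= T + tau)%N ->
       dual_norm N p (g (t - tau)%N - (beta t / eta t) *: Phi t.+1 (xk t.+1))
         <= L') ->
    (forall t, (1 <= t <= (T + tau).+1)%N ->
       dual_norm N p (xk t) <= rad /\ dual_norm N p (xhat t) <= rad) ->
    K xstar ->
    (forall x, K x ->
       cumulative_loss N f xu T xstar <= cumulative_loss N f xu T x) ->
    (forall t, (tau < t <= T + tau)%N ->
       bregman p M dM xstar (xhat t) <= D) ->
    regret N f xu K xhat T <= C3 * Num.sqrt (LM * tau%:R * T%:R).
Proof.
(* The hypotheses bound dual norms while [hMLM] measures with [N]; [c] converts one into the
   other. *)
have [c0 hc0] := pairing_inverse_bounded hp.
pose c := `|c0|; have c_ge0 : 0 <= c by exact: normr_ge0.
have hc y : N y <= c * dual_norm N p y.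
  apply: le_trans (hc0 y) _.
  by rewrite ler_wpM2r ?(dual_norm_ge0 hN hp)// ler_norm.
have N_le y a : dual_norm N p y <= a -> N y <= c * a.
  by move=> ya; apply: le_trans (hc y) _; rewrite ler_wpM2l.
have N_ge0 := product_norm_ge0 hN.
have LM_ge0 := ltW hLM; have L'_ge0 := ltW hL'; have rad_ge0 := ltW hrad.
(* Bound on the pairing with the known context: distance between two iterates, divergence, and
   mirror-step error. *)
pose G := 2 * c * rad * rad + `|D| + LM * c * rad ^+ 2.
(* The summands come from the drift over the delay, from the telescoped divergences, and from the
   terms of order [eta]. *)
exists (2 * c * L' * rad + `|D| * L' / rad
        + 2 * (LM * c * L' ^+ 2 + G) * rad / (L' * LM)).
move=> tau T sigma eta beta Phi f xk xu xhat g xs tau_gt0 sigma_gt0 sigma2.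
move=> heta hbeta hPhi _ _ _ hA hdual hrad_le Kxs xs_min hB.
have sigma_ge0 := ltW sigma_gt0.
pose q (n : nat) : R := (Num.sqrt n%:R)^-1.
pose b s := bregman p M dM xs (xhat (s + tau)%N).
pose gt s := g s - beta (s + tau)%N *: xk (s + tau).+1.
have q_ge0 n : 0 <= q n by rewrite invr_ge0 sqrtr_ge0.
have q_gt0 n : (0 < n)%N -> 0 < q n by move=> ?; rewrite invr_gt0 sqrtr_gt0 ltr0n.
have shift s : (0 < s <= T)%N -> (tau < s + tau <= T + tau)%N.
  by move=> /andP[s0 sT]; rewrite -[X in (X < _)%N]add0n ltn_add2r s0 leq_add2r.
have etaE s : (0 < s)%N -> eta (s + tau)%N = sigma * q s.
  by move=> s0; rewrite heta ?addnK// -[X in (X < _)%N]add0n ltn_add2r.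
have betaE s : (0 < s)%N -> beta (s + tau)%N = sigma * q s.
  by move=> s0; rewrite hbeta ?addnK// -[X in (X < _)%N]add0n ltn_add2r.
have eta_gt0 s : (0 < s)%N -> 0 < eta (s + tau)%N.
  by move=> s0; rewrite etaE// mulr_gt0// q_gt0.
have gt_dual s : (0 < s <= T)%N -> dual_norm N p (gt s) <= L'.
  move=> hs; have /andP[s0 _] := hs; have := hdual _ (shift s hs).
  rewrite addnK hPhi ?shift// betaE// -etaE// divff ?scale1r ?gt_eqF ?eta_gt0//.
  by rewrite /gt betaE// -etaE.
(* Since [beta = eta], the term [beta *: Phi] is [eta *: (beta *: xk)] and merges with the gradient
   into [gt]. *)
have update s : (0 < s <= T)%N -> xhat (s + tau).+1 =
    dMs (dM (xhat (s + tau)%N) - eta (s + tau)%N *: gt s).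
  move=> hs; have /andP[s0 _] := hs.
  rewrite (DCOMD_update hA (shift s hs)) addnK hPhi ?shift//.
  by rewrite /gt betaE// -etaE// scalerBr opprB addrA addrAC.
have drift r : (0 < r <= T + tau)%N ->
    N (xhat r.+1 - xhat r) <= LM * c * L' * sigma * q (r - tau)%N.
  (* Up to round [tau.+1] the iterates are 0, so nothing moves while [r <= tau]. *)
  move=> /andP[r0 rT]; have [r_le|r_gt] := leqP r tau.
    rewrite !(DCOMD_init hA) ?ltnS ?r0 ?leqW// subrr (product_norm0 hN).
    by rewrite !mulr_ge0 ?q_ge0.
  have hs : (0 < r - tau <= T)%N by rewrite subn_gt0 r_gt leq_subLR addnC.
  have := update _ hs; rewrite subnK ?(ltnW r_gt)// => ->.
  apply: le_trans (hMLM _ _) _; rewrite -!mulrA ler_wpM2l ?LM_ge0//.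
  have := eta_gt0 _ (proj1 (andP hs)); rewrite subnK ?(ltnW r_gt)// => eta0.
  rewrite (product_normZ hN) gtr0_norm//.
  have := etaE _ (proj1 (andP hs)); rewrite subnK ?(ltnW r_gt)// => <-.
  rewrite mulrC mulrA ler_wpM2r ?(ltW eta0)// N_le// gt_dual//.
have window s : (0 < s <= T)%N -> p (xhat s - xhat (s + tau)%N) (gt s) <=
    LM * c * L' ^+ 2 * sigma * \sum_(i < tau) q (s + i - tau)%N.
  move=> hs; apply: le_trans (le_pairing hN hp _ _) _.
  have := gt_dual s hs; have := dual_norm_ge0 hN hp (gt s).
  have : N (xhat s - xhat (s + tau)%N) <=
         LM * c * L' * sigma * \sum_(i < tau) q (s + i - tau)%N.
    rewrite -(product_normN hN) opprB.
    apply: le_trans (product_norm_telescope hN _ _ _) _.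
    rewrite mulr_sumr; apply: ler_sum => i _; apply: drift.
    have /andP[s0 sT] := hs.
    by rewrite ltn_addr//= leq_add// ltnW.
  have := N_ge0 (xhat s - xhat (s + tau)%N).
  move: (N _) (dual_norm _ _ _) => u v u0 uS v0 vL.
  apply: le_trans (ler_pM u0 v0 uS vL) _.
  by rewrite le_eqVlt; apply/orP; left; apply/eqP; ring.
have descent s : (0 < s <= T)%N -> p (xhat (s + tau)%N - xs) (gt s) <=
    Num.sqrt s%:R / sigma * (b s - b s.+1) + LM * c * L' ^+ 2 * sigma * q s.
  move=> hs; have /andP[s0 _] := hs.
  (* The step [h *: gt s] puts a factor [h] on the pairing and [h ^+ 2] in the error; division by
     [h] leaves the weight [h^-1] on the divergences. *)
  have := mirror_step hN hp hM (xhat (s + tau)%N) (eta (s + tau)%N *: gt s) xs hMLM.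
  rewrite -update// (pairingZr hp) (product_normZ hN) gtr0_norm ?eta_gt0//.
  have := dual_normZ_le hN hp (eta (s + tau)%N) (gt s).
  rewrite gtr0_norm ?eta_gt0// -/(b s) -[bregman _ _ _ _ (xhat _.+1)]/(b s.+1).
  have := eta_gt0 s s0; set h := eta _ => h0 hd hP.
  have -> : Num.sqrt s%:R / sigma = h^-1 by rewrite /h etaE// invfM invrK mulrC.
  rewrite -mulrA -etaE// -/h -(ler_pM2l h0) mulrDr mulrA divff ?gt_eqF// mul1r.
  apply: le_trans hP _; rewrite lerD2l.
  have Nc := N_le _ _ (gt_dual s hs).
  have : LM * (h * N (gt s)) * dual_norm N p (h *: gt s) <=
         LM * (h * (c * L')) * (h * L').
    apply: ler_pM; rewrite ?mulr_ge0 ?LM_ge0 ?(ltW h0) ?dual_norm_ge0//.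
      by rewrite !ler_wpM2l ?LM_ge0 ?(ltW h0).
    by apply: le_trans hd _; rewrite ler_wpM2l ?(ltW h0)// gt_dual.
  by move=> /le_trans; apply; rewrite le_eqVlt; apply/orP; left; apply/eqP; ring.
(* The mirror step with y = xk bounds the pairing with xstar although K may be
   unbounded. *)
have known s : (0 < s <= T)%N -> p (xhat s - xs) (xk (s + tau).+1) <= G.
  move=> hs; have /andP[s0 sT] := hs.
  have [|kd _] := hrad_le (s + tau).+1; first by rewrite !ltnS leq0n leq_add2r.
  have [|_ hd] := hrad_le s; first by rewrite s0 leqW ?(leq_trans sT) ?leq_addr.
  have [|_ hd'] := hrad_le (s + tau)%N.
    by rewrite addn_gt0 s0 leqW ?leq_add2r.
  set y := xk _ in kd *.
  have := mirror_step hN hp hM (xhat (s + tau)%N) y xs hMLM.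
  have := bregman_ge0 hM xs (dMs (dM (xhat (s + tau)%N) - y)).
  have := hB _ (shift s hs); have := ler_norm D.
  (* [hB] speaks of rounds after [tau], so the mirror step is taken at round [s + tau]; the two
     iterates differ by at most [2 * c * rad]. *)
  have : p (xhat s - xhat (s + tau)%N) y <= 2 * c * rad * rad.
    apply: le_trans (le_pairing hN hp _ _) _.
    apply: ler_pM; rewrite ?N_ge0 ?dual_norm_ge0//.
    apply: le_trans (product_norm_triangle hN _ _) _; rewrite (product_normN hN).
    by have := N_le _ _ hd; have := N_le _ _ hd'; lra.
  have : LM * N y * dual_norm N p y <= LM * c * rad ^+ 2.
    rewrite expr2 mulrA; apply: ler_pM; rewrite ?mulr_ge0 ?dual_norm_ge0 ?LM_ge0//.
    by rewrite -mulrA ler_wpM2l ?LM_ge0// N_le.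
  rewrite /G !(pairingDl hp) !(pairingNl hp); lra.
have round s : (0 < s <= T)%N ->
    loss N f xu s (xhat s) - loss N f xu s xs <=
    LM * c * L' ^+ 2 * sigma * \sum_(i < tau) q (s + i - tau)%N
    + Num.sqrt s%:R / sigma * (b s - b s.+1)
    + (LM * c * L' ^+ 2 + G) * sigma * q s.
  move=> hs; have /andP[s0 _] := hs.
  have := DCOMD_grad hA (shift s hs) xs; rewrite addnK.
  have := window s hs; have := descent s hs.
  have : sigma * q s * p (xhat s - xs) (xk (s + tau).+1) <= sigma * q s * G.
    by rewrite ler_wpM2l ?known// mulr_ge0// ltW.
  rewrite /gt betaE// !(pairingDl hp) !(pairingNl hp) !(pairingDr hp).
  rewrite !(pairingNr hp) !(pairingZr hp); lra.
have infE : inf [set cumulative_loss N f xu T x | x in K] = cumulative_loss N f xu T xs.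
  apply/le_anti/andP; split.
    apply: ge_inf; last by exists xs.
    by exists (cumulative_loss N f xu T xs) => _ [x Kx <-]; exact: xs_min.
  apply: lb_le_inf; first by exists (cumulative_loss N f xu T xs); exists xs.
  by move=> _ [x Kx <-]; exact: xs_min.
rewrite /regret infE /cumulative_loss -sumrB.
have regret_le : \sum_(1 <= t < T.+1) (loss N f xu t (xhat t) - loss N f xu t xs)
    <= LM * c * L' ^+ 2 * sigma * (tau%:R * (2 * Num.sqrt T%:R))
       + Num.sqrt T%:R / sigma * `|D|
       + (LM * c * L' ^+ 2 + G) * sigma * (2 * Num.sqrt T%:R).
  apply: le_trans; first by apply: ler_sum_nat => s hs; exact: (round s hs).
  rewrite !big_split/= -!mulr_sumr; apply: lerD; first apply: lerD.
  - by rewrite ler_wpM2l ?sum_invsqrt_window// !mulr_ge0 ?exprn_ge0.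
  - have bD s : (1 <= s <= T)%N -> b s <= `|D|.
      by move=> hs; apply: le_trans (hB _ (shift s hs)) (ler_norm _).
    have w0 : Num.sqrt 0%:R / sigma = 0 by rewrite sqrtr0 mul0r.
    have w_incr n : Num.sqrt n%:R / sigma <= Num.sqrt n.+1%:R / sigma.
      by rewrite ler_pM2r ?invr_gt0// ler_sqrt ?ler0n// ler_nat.
    have := abel_sum_le (w := fun n => Num.sqrt n%:R / sigma) w0 w_incr bD.
    (* The boundary term is dropped, divergences being nonnegative. *)
    move=> /le_trans; apply; rewrite gerBl.
    by apply: mulr_ge0; [rewrite divr_ge0 ?sqrtr_ge0|exact: (bregman_ge0 hM)].
  - rewrite ler_wpM2l//; last first.
      have := sum_invsqrt_le (R := R) 0 T; rewrite subn0.
      by under eq_bigr do rewrite subn0.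
    by rewrite /G !(mulr_ge0, addr_ge0) ?exprn_ge0.
apply: le_trans regret_le _.
set r := Num.sqrt (LM * tau%:R).
have r_gt0 : 0 < r by rewrite sqrtr_gt0 mulr_gt0// ltr0n.
have r2 : r ^+ 2 = LM * tau%:R by rewrite sqr_sqrtr// mulr_ge0 ?ler0n// ltW.
have -> : Num.sqrt (LM * tau%:R * T%:R) = r * Num.sqrt T%:R.
  by rewrite sqrtrM// mulr_ge0 ?ler0n// ltW.
have sigmaE : sigma = rad / (L' * r).
  apply/eqP; rewrite -(@eqrXn2 _ 2)// ?divr_ge0 ?mulr_ge0 ?ltW//; apply/eqP.
  by rewrite sigma2 expr_div_n exprMn r2; congr (_ / _); ring.
(* [tau >= 1] enters here: the terms of order [eta] carry [(r ^+ 2)^-1] relative to [r * S], which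
   is at most [LM^-1], free of [tau]. *)
have LM_le : LM <= r ^+ 2 by rewrite r2 ler_peMr ?ler1n// ltW.
set S := Num.sqrt T%:R; have S0 : 0 <= S by rewrite sqrtr_ge0.
have -> : LM * c * L' ^+ 2 * sigma * (tau%:R * (2 * S)) =
          2 * c * L' * rad * (r * S).
  rewrite sigmaE; transitivity (2 * c * L' ^+ 2 * (rad / (L' * r)) * S * (r ^+ 2)).
    by rewrite r2; ring.
  by field; rewrite !gt_eqF.
have -> : S / sigma * `|D| = `|D| * L' / rad * (r * S).
  by rewrite sigmaE; field; rewrite !gt_eqF.
rewrite [leRHS]mulrDl [X in _ <= X + _]mulrDl lerD2l.
have G0 : 0 <= LM * c * L' ^+ 2 + G.
  by rewrite /G !(mulr_ge0, addr_ge0) ?exprn_ge0.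
have -> : (LM * c * L' ^+ 2 + G) * sigma * (2 * S) =
          2 * (LM * c * L' ^+ 2 + G) * rad / L' * (r * S) * (r ^+ 2)^-1.
  by rewrite sigmaE; field; rewrite !gt_eqF.
have -> : 2 * (LM * c * L' ^+ 2 + G) * rad / (L' * LM) * (r * S) =
          2 * (LM * c * L' ^+ 2 + G) * rad / L' * (r * S) * LM^-1.
  by field; rewrite !gt_eqF.
rewrite ler_wpM2l ?lef_pV2 ?posrE ?exprn_gt0//.
by rewrite !mulr_ge0 ?invr_ge0// ltW.
Qed.
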